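(* Let $n\ge2$ be an integer. Then $F_n\ge n/(2-\log 2)$.
   Context: For real $x\ge n$ let $\mathcal{A}(x)=\{\mathbf{a}=(a_2,\dots,a_{n+1})\in\mathbb{R}^n:\ 1=a_2\le\cdots\le a_{n+1},\ a_2+\cdots+a_{n+1}=x\}$. For $\mathbf{a}\in\mathcal{A}(x)$ and $2\le k\le n+1$ let $A_k(x,\mathbf{a})=2x-2(n-k+1)-\sum_{i=2}^k a_i$, $F(x,\mathbf{a})=\max_{2\le k\le n+1}A_k(x,\mathbf{a})/a_k$, $F(x)=\min_{\mathbf{a}\in\mathcal{A}(x)}F(x,\mathbf{a})$, and $F_n=\inf_{x\ge n}F(x)$. *)

(* Defs.v *)
From HB Require Import structures.
From mathcomp Require Import all_boot all_order all_algebra.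
From mathcomp Require Import all_classical all_reals all_analysis.
From mathcomp Require Import lra.

Set Implicit Arguments.
Unset Strict Implicit.
Unset Printing Implicit Defensive.

Import Order.TTheory GRing.Theory Num.Theory.
Import numFieldNormedType.Exports.

Local Open Scope classical_set_scope.
Local Open Scope ring_scope.

Section Extrema.
Variable R : realType.
Implicit Types (S : set R) (m : R).

Definition is_max S m := S m /\ ubound S m.
Definition is_min S m := S m /\ lbound S m.

(* The value 0 is returned only when the extremum is not attained; Fxa_max,   *)
(* Fx_min and Fn_has_inf below show that the default values of setmax, setmin *)
(* and inf never occur in Fxa, Fx and Fn for n >= 2 and x >= n.               *)
Definition setmax S : R := xget 0 [set m | is_max S m].
Definition setmin S : R := xget 0 [set m | is_min S m].

End Extrema.

(* A vector (a_2, ..., a_{n+1}) is a row vector indexed by j = 0, ..., n - 1: *)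
(* the entry a 0 j is a_{j+2}, and k = j + 2 gives n - k + 1 = n - j.+1.      *)
Section Functional.
Variables (R : realType) (n : nat).
Implicit Types (x : R) (a : 'rV[R]_n).

Definition calA x : set 'rV[R]_n :=
  [set a | [/\ forall j : 'I_n, j = 0%N :> nat -> a 0 j = 1,
               forall i j : 'I_n, (i <= j)%N -> a 0 i <= a 0 j
             & \sum_(j < n) a 0 j = x]].

Definition Ak x a (j : 'I_n) : R :=
  2 * x - 2 * (n - j.+1)%:R - \sum_(i < n | (i <= j)%N) a 0 i.

Definition Fxa x a : R := setmax [set Ak x a j / a 0 j | j in [set: 'I_n]].

Definition Fx x : R := setmin [set Fxa x a | a in calA x].

Definition Fn : R := inf [set Fx x | x in [set x | n%:R <= x]].

End Functional.

Section WellDefined.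
Variable R : realType.

Lemma is_max_range (n : nat) (r : 'I_n.+1 -> R) :
  is_max [set r j | j in [set: 'I_n.+1]]
         (\big[Num.max/r ord0]_(j < n.+1) r j).
Proof.
split; last by move=> _ [j _ <-]; exact: le_bigmax.
elim/big_ind: _ => [|u v [i _ <-] [j _ <-]|i _]; first by exists ord0.
  by case: (leP (r i) (r j)) => _; [exists j|exists i].
by exists i.
Qed.

Lemma setmaxE (S : set R) m : is_max S m -> setmax S = m.
Proof.
move=> [Sm mub]; apply: xget_unique => // y [Sy yub].
by apply/eqP; rewrite eq_le mub// yub.
Qed.

Lemma FxaE (n : nat) (x : R) (a : 'rV[R]_n.+1) :
  Fxa x a = \big[Num.max/Ak x a ord0 / a 0 ord0]_(j < n.+1) (Ak x a j / a 0 j).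
Proof. exact/setmaxE/(is_max_range (fun j => Ak x a j / a 0 j)). Qed.

Lemma Fxa_max (n : nat) (x : R) (a : 'rV[R]_n) : (0 < n)%N ->
  is_max [set Ak x a j / a 0 j | j in [set: 'I_n]] (Fxa x a).
Proof.
case: n a => [//|n] a _; rewrite FxaE.
exact: (is_max_range (fun j => Ak x a j / a 0 j)).
Qed.

Lemma calA_ge1 (n : nat) (x : R) (a : 'rV[R]_n) :
  calA x a -> forall j, 1 <= a 0 j.
Proof.
case: n a => [|n] a [a0 amon _] j; first by case: j.
by rewrite -(a0 ord0 erefl); exact: amon.
Qed.

Lemma calA_nonempty (n : nat) (x : R) : (2 <= n)%N -> n%:R <= x ->
  @calA R n x !=set0.
Proof.
case: n => [//|n]; rewrite ltnS => n0 nx.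
exists (\row_j (if j == ord_max then x - n%:R else 1)); split.
- by move=> j j0; rewrite mxE -val_eqE /= j0 ltn_eqF.
- move=> i j ij; rewrite !mxE; case: eqP => [ei|_]; case: eqP => [ej|ej] //.
    case: ej; apply/val_inj/eqP; rewrite eqn_leq -ltnS ltn_ord.
    by rewrite -[X in (X <= _)%N]/(val (@ord_max n)) -ei.
  by rewrite lerBrDl natr1.
- rewrite big_ord_recr /= mxE eqxx.
  under eq_bigr => i _.
    rewrite mxE -val_eqE /= ltn_eqF; last exact: ltn_ord.
    over.
  by rewrite sumr_const card_ord addrC subrK.
Qed.

Lemma continuous_coordsum (n : nat) (P : pred 'I_n) :
  continuous (fun a : 'rV[R]_n => \sum_(i < n | P i) a 0 i : R).
Proof.
move=> a; apply: (@cvg_big R^o 'I_n +%R 0 P).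
  exact: (@add_continuous R^o).
  exact: (@nbhs_filter 'rV[R]_n a).
by move=> i _; exact: coord_continuous.
Qed.

Lemma calA_compact (n : nat) (x : R) : compact (@calA R n x).
Proof.
apply: (@subclosed_compact 'rV[R]_n _
  [set v : 'rV[R]_n | forall i, `[1, x]%classic (v ord0 i)]).
- have -> : @calA R n x =
    (\bigcap_(j in [set j : 'I_n | j = 0%N :> nat])
      [set a : 'rV[R]_n | a 0 j = 1]) `&`
    (\bigcap_(p in [set p : 'I_n * 'I_n | (p.1 <= p.2)%N])
      [set a : 'rV[R]_n | 0 <= a 0 p.2 - a 0 p.1]) `&`
    [set a : 'rV[R]_n | \sum_(j < n) a 0 j = x].
    apply/seteqP; split => [a [h1 h2 h3]|a [[h1 h2] h3]].
      split=> //; split=> [j /h1//|p /= /h2]; by rewrite subr_ge0.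
    split=> // i j ij; have := h2 (i, j) ij; by rewrite /= subr_ge0.
  apply: closedI; first apply: closedI.
  + apply: closed_bigI => j _.
    apply: (@preimage_closed _ R^o (fun a : 'rV[R]_n => a 0 j) [set y | y = 1]).
      by move=> a _; exact: coord_continuous.
    exact: closed_eq.
  + apply: closed_bigI => p _.
    apply: (@preimage_closed _ R^o (fun a : 'rV[R]_n => a 0 p.2 - a 0 p.1)
      [set y | 0 <= y]); last exact: closed_ge.
    by move=> a _; apply: (@cvgB _ R^o); [exact: (@nbhs_filter 'rV[R]_n a)
      |exact: coord_continuous..].
  + apply: (@preimage_closed _ R^o (fun a : 'rV[R]_n => \sum_(j < n) a 0 j)
      [set y | y = x]); last exact: closed_eq.
    by move=> a _; exact: continuous_coordsum.
- by apply: (@rV_compact R^o n (fun=> `[1, x]%classic)) => i; exact: segment_compact.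
- move=> a Aa j /=; have a1 := calA_ge1 Aa; rewrite in_itv/= a1/=.
  have [_ _ <-] := Aa.
  by rewrite (bigD1 j)//= lerDl sumr_ge0// => i _; exact: le_trans (a1 i).
Qed.

Lemma Fxa_continuous (n : nat) (x : R) :
  {within @calA R n.+1 x, continuous (fun a => Fxa x a)}.
Proof.
apply: continuous_in_subspaceT => a; rewrite inE => Aa.
have -> : (fun a : 'rV[R]_n.+1 => Fxa x a) = fun a =>
    \big[Num.max/Ak x a ord0 / a 0 ord0]_(j < n.+1) (Ak x a j / a 0 j).
  by apply/funext => b; rewrite FxaE.
have cr j : {for a, continuous
    (fun a : 'rV[R]_n.+1 => Ak x a j / a 0 j : R^o)}.
  apply: (@continuousM R _ (fun a : 'rV[R]_n.+1 => Ak x a j)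
    (fun a : 'rV[R]_n.+1 => (a 0 j)^-1)).
    apply: (@continuousB R R^o _ (fun=> 2 * x - 2 * (n.+1 - j.+1)%:R)
      (fun a : 'rV[R]_n.+1 => \sum_(i < n.+1 | (i <= j)%N) a 0 i)).
      exact: cst_continuous.
    exact: continuous_coordsum.
  apply: (@continuousV R _ (fun a : 'rV[R]_n.+1 => a 0 j)).
    by rewrite gt_eqF// (lt_le_trans ltr01)// (calA_ge1 Aa).
  exact: coord_continuous.
elim: (index_enum _) => [|j s IHs].
  by under [X in continuous_at _ X]eq_fun do rewrite big_nil; exact: cr.
under [X in continuous_at _ X]eq_fun do rewrite big_cons.
exact: (@continuous_max R _ (fun b : 'rV[R]_n.+1 => Ak x b j / b 0 j)
  _ a (cr j) IHs).
Qed.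

Lemma Fx_min (n : nat) (x : R) : (2 <= n)%N -> n%:R <= x ->
  is_min [set Fxa x a | a in @calA R n x] (Fx n x).
Proof.
case: n => [//|n] n2 nx.
have [c cA cmin] := EVT_min_rV (calA_nonempty n2 nx) (@calA_compact n.+1 x)
  (@Fxa_continuous n x).
apply: xgetPex; exists (Fxa x c); split; first by exists c => //; rewrite -inE.
by move=> _ [a Aa <-]; apply: cmin; rewrite inE.
Qed.

Lemma Fn_has_inf (n : nat) : (2 <= n)%N ->
  has_inf [set Fx n x | x in [set x : R | n%:R <= x]].
Proof.
move=> n2; split; first by exists (Fx n n%:R), n%:R => /=.
exists 0 => _ [x /= nx <-]; have [[a Aa <-] _] := Fx_min n2 nx.
case: n n2 nx a Aa => [//|n] n2 nx a Aa.
have [_ /(_ (Ak x a ord0 / a 0 ord0)) h] := Fxa_max x a (ltn0Sn n).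
apply: (@le_trans _ _ (Ak x a ord0 / a 0 ord0)); last by apply: h; exists ord0.
have [a0 _ _] := Aa; rewrite a0// divr1 /Ak.
rewrite (big_pred1 ord0) => [|i]; last by rewrite /= leqn0 -val_eqE.
rewrite a0// subSS subn0; move: nx; rewrite -natr1 => nx; lra.
Qed.

End WellDefined.

(* Main.v *)
Require Import Defs.
From HB Require Import structures.
From mathcomp Require Import all_boot all_order all_algebra.
From mathcomp Require Import all_classical all_reals all_analysis.
From mathcomp Require Import ring lra.

Set Implicit Arguments.
Unset Strict Implicit.
Unset Printing Implicit Defensive.

Import Order.TTheory GRing.Theory Num.Theory.
Local Open Scope ring_scope.

(** Fix [a] in [calA x] and let [t] bound all the ratios [A_k / a_k].  Since
    [A_(k-1) - A_k = a_k - 2], the inequality [A_k <= t * a_k] says exactly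
    that the slack [2 * t - A_k] satisfies
    [2 * t - A_(k-1) <= (1 + 1/t) * (2 * t - A_k)].  The slack at [k = n + 1] is
    [2 * t - x], and [a_i >= 1] bounds from below the slack [r] steps earlier:
    [2 * t - 2 * x + n + r <= (1 + 1/t) ^ r * (2 * t - x)] for [0 <= r <= n].
    If some power [(1 + 1/t) ^ r] were equal to [2], then [x] would cancel and
    leave [r <= 2 * t - n], with [r] about [t * ln 2].  In general one takes the
    last [r] with [(1 + 1/t) ^ r <= 2] and uses the inequality at [r] or at
    [r + 1], according to the position of [2 * t - 2 * x + n + r] relative to
    the point [t] at which both give the same bound. *)

Lemma exists_crossing (d : Order.disp_t) (T : orderType d) (u : nat -> T)
    (c : T) (n : nat) :
  (u 0%N <= c)%O -> (c < u n)%O ->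
  exists r, [/\ (r < n)%N, (u r <= c)%O & (c < u r.+1)%O].
Proof.
move=> u0c; elim: n => [|n IHn] cu; first by rewrite ltNge u0c in cu.
have [unc|/IHn[r [rn urc cur]]] := leP (u n) c; first by exists n.
by exists r; split=> //; exact: ltnW.
Qed.

Lemma geometric_growth_bound (R : numDomainType) (g : R) (u : nat -> R)
    (n : nat) :
  0 <= g -> (forall j, (j < n)%N -> u j <= g * u j.+1) ->
  forall r, (r <= n)%N -> u (n - r)%N <= g ^+ r * u n.
Proof.
move=> g0 ustep; elim=> [|r IHr] rn; first by rewrite subn0 mul1r.
apply: (@le_trans _ _ (g * u (n - r)%N)); last first.
  by rewrite exprS -mulrA ler_wpM2l// IHr// ltnW.
by have := ustep (n - r.+1)%N; rewrite subnSK//; apply; exact: leq_subr.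
Qed.

Lemma bernoulli_le (R : realDomainType) (x : R) (n : nat) :
  -1 <= x -> 1 + x *+ n <= (1 + x) ^+ n.
Proof.
move=> x1; elim: n => [|n IHn]; first by rewrite addr0.
have x1_ge0 : 0 <= 1 + x by lra.
rewrite exprS; apply: le_trans (ler_wpM2l x1_ge0 IHn).
rewrite -subr_ge0 (_ : _ - _ = x ^+ 2 *+ n) ?mulrn_wge0 ?sqr_ge0//.
by rewrite mulrS -[x *+ n]mulr_natr -[_ ^+ 2 *+ n]mulr_natr; ring.
Qed.

Section GrowthLogarithm.
Variables (R : realType) (t : R).
Hypothesis t_gt0 : 0 < t.

Let g : R := 1 + t^-1.

Let g_gt0 : 0 < g.
Proof. by rewrite addr_gt0 ?invr_gt0. Qed.

Lemma mul_ln1DV_le1 : t * ln (1 + t^-1) <= 1.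
Proof.
rewrite -ler_pdivlMl// mulr1; apply: le_ln1Dx.
by rewrite (lt_trans (ltrN10 R))// invr_gt0.
Qed.

Lemma mul_ln_le_geometric (c : R) (r : nat) :
  0 < c -> t * ln c <= r%:R + t * (c / (1 + t^-1) ^+ r - 1).
Proof.
move=> c_gt0; rewrite -/g.
have gr_gt0 : 0 < g ^+ r by rewrite exprn_gt0.
have ln_ratio : ln (c / g ^+ r) <= c / g ^+ r - 1.
  rewrite -[in ln _](subrKC 1 (c / g ^+ r)) le_ln1Dx//.
  by rewrite ltrBrDr addNr divr_gt0.
rewrite -[in ln c](divfK (lt0r_neq0 gr_gt0) c).
rewrite lnM ?posrE ?divr_gt0// lnXn// mulrDr addrC lerD ?ler_pM2l//.
by rewrite mulrnAr lerMn2r mul_ln1DV_le1 orbT.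
Qed.

Lemma mul_ln_le_growth (c b e : R) (n : nat) :
    1 <= c -> t * (c - 1) < n%:R ->
    (forall r, (r <= n)%N -> c * (b + r%:R) <= (1 + t^-1) ^+ r * (b + e)) ->
  t * ln c <= e.
Proof.
rewrite -/g => c_ge1 n_large growth.
have c_lt_gn : c < g ^+ n.
  have tV : t * (t^-1 *+ n) = n%:R by rewrite mulrnAr divff ?lt0r_neq0.
  apply: lt_le_trans (bernoulli_le n _); last first.
    by rewrite (le_trans (lerN10 R))// invr_ge0 ltW.
  by rewrite -ltrBlDl -(ltr_pM2l t_gt0) tV.
have [r [rn gr_le gr1_gt]] := exists_crossing c_ge1 c_lt_gn.
have gr_gt0 : 0 < g ^+ r by rewrite exprn_gt0.
have c_gt0 : 0 < c := lt_le_trans ltr01 c_ge1.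
apply: le_trans (mul_ln_le_geometric r c_gt0) _; rewrite -/g.
have [t_le|/ltW t_ge] := leP t (b + r%:R).
- have := growth r (ltnW rn).
  rewrite -ler_pdivrMl// mulrCA mulrA => growth_r.
  have ratio_ge1 : 1 <= c / g ^+ r by rewrite ler_pdivlMr ?mul1r.
  by nra.
- have := growth r.+1 rn.
  rewrite -ler_pdivrMl ?exprn_gt0// mulrCA mulrA -natr1 => growth_r1.
  have ratio_le1 : c / g ^+ r.+1 <= 1.
    by rewrite ler_pdivrMr ?exprn_gt0// mul1r ltW.
  have -> : t * (c / g ^+ r - 1) = c / g ^+ r.+1 * (t + 1) - t.
    rewrite exprSr invfM /g; field.
    by rewrite !lt0r_neq0// addr_gt0.
  by nra.
Qed.

End GrowthLogarithm.

Section PrefixSum.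
Variables (V : nmodType) (n : nat).
Implicit Types (F : 'I_n -> V).

Definition prefix_sum F (k : nat) : V := \sum_(i < n | (i < k)%N) F i.

Lemma prefix_sumS F (j : 'I_n) : prefix_sum F j.+1 = prefix_sum F j + F j.
Proof.
rewrite /prefix_sum (bigD1 j)//= addrC; congr (_ + _); apply: eq_bigl => i.
by rewrite ltnS ltn_neqAle andbC -val_eqE.
Qed.

Lemma prefix_sum_full F : prefix_sum F n = \sum_(i < n) F i.
Proof. by apply: eq_bigl => i; rewrite ltn_ord. Qed.

End PrefixSum.

Lemma prefix_sum_ge (R : numDomainType) (n : nat) (F : 'I_n -> R) (c : R) :
  (forall i, c <= F i) -> forall k, (k <= n)%N -> c *+ k <= prefix_sum F k.
Proof.
move=> cF k kn; rewrite -[k in c *+ k]card_ord -sumr_const.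
by rewrite (big_ord_widen n (fun=> c) kn); exact: ler_sum.
Qed.

Section ExtendedAk.
Variables (R : realType) (n : nat) (x : R) (a : 'rV[R]_n).

(* [Ak_ext k] is the paper's [A_{k+1}], extended to [k = 0]. *)
Definition Ak_ext (k : nat) : R :=
  2 * x - 2 * (n - k)%:R - prefix_sum (a 0) k.

Lemma AkE (j : 'I_n) : Ak x a j = Ak_ext j.+1.
Proof. by []. Qed.

Lemma Ak_extS (j : 'I_n) : Ak_ext j.+1 = Ak_ext j + 2 - a 0 j.
Proof.
rewrite /Ak_ext prefix_sumS -[in (n - j)%N](subnSK (ltn_ord j)) -natr1; lra.
Qed.

Hypothesis Aa : calA x a.

Lemma Ak_ext_full : Ak_ext n = x.
Proof.
by have [_ _ suma] := Aa; rewrite /Ak_ext prefix_sum_full suma subnn; lra.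
Qed.

Lemma Ak_ext_le (k : nat) : (k <= n)%N -> Ak_ext k <= 2 * x - 2 * n%:R + k%:R.
Proof.
move=> kn; have := prefix_sum_ge (calA_ge1 Aa) kn.
by rewrite /Ak_ext natrB//; lra.
Qed.

Section RatioBound.
Variable t : R.
Hypotheses (t_gt0 : 0 < t) (Ak_le : forall j, Ak x a j <= t * a 0 j).

Lemma Ak_ext_slack_growth (k : nat) : (k < n)%N ->
  2 * t - Ak_ext k <= (1 + t^-1) * (2 * t - Ak_ext k.+1).
Proof.
move=> kn; rewrite -(ler_pM2l t_gt0) mulrA [t * (1 + _)]mulrDr mulr1.
rewrite divff ?lt0r_neq0//.
by have := Ak_le (Ordinal kn); rewrite AkE (Ak_extS (Ordinal kn)) /=; lra.
Qed.

Lemma Ak_ext_slack_bound (r : nat) : (r <= n)%N ->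
  2 * t - 2 * x + n%:R + r%:R <= (1 + t^-1) ^+ r * (2 * t - x).
Proof.
move=> rn; have g_ge0 : 0 <= 1 + t^-1 by rewrite addr_ge0// invr_ge0 ltW.
have := geometric_growth_bound g_ge0 Ak_ext_slack_growth rn.
rewrite Ak_ext_full; apply: le_trans.
by have := Ak_ext_le (leq_subr r n); rewrite natrB//; lra.
Qed.

End RatioBound.

End ExtendedAk.

Lemma ln2_le1 (R : realType) : ln 2 <= 1 :> R.
Proof. by apply: (@le_ln1Dx R 1); lra. Qed.

Section RatioLowerBound.
Variables (R : realType) (n : nat) (x : R) (a : 'rV[R]_n).
Hypotheses (n_gt0 : (0 < n)%N) (nx : n%:R <= x) (Aa : calA x a).

Lemma Ak_le_Fxa (j : 'I_n) : Ak x a j <= Fxa x a * a 0 j.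
Proof.
have [_ ub] := Fxa_max x a n_gt0.
rewrite -ler_pdivrMr ?(lt_le_trans ltr01) ?(calA_ge1 Aa)//.
by apply: ub; exists j.
Qed.

Lemma Fxa_gt0 : 0 < Fxa x a.
Proof.
have [a0 _ _] := Aa; have := Ak_le_Fxa (Ordinal n_gt0).
rewrite AkE Ak_extS a0// mulr1 /Ak_ext /prefix_sum big_pred0//= subn0 subr0.
by move: nx; lra.
Qed.

Lemma Fxa_ge : n%:R / (2 - ln 2) <= Fxa x a.
Proof.
have t_gt0 := Fxa_gt0; have growth := Ak_ext_slack_bound Aa t_gt0 Ak_le_Fxa.
move: (Fxa x a) t_gt0 growth => t t_gt0 growth.
have ln2_le := ln2_le1 R.
rewrite ler_pdivrMr; last by lra.
have [nt|tn] := leP n%:R t; first by nra.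
suff : t * ln 2 <= 2 * t - n%:R by lra.
apply: (mul_ln_le_growth (b := 2 * t - 2 * x + n%:R) (n := n) t_gt0).
- by lra.
- by lra.
- by move=> r /growth; lra.
Qed.

End RatioLowerBound.

Theorem theorem8p1 (R : realType) (n : nat) (hn : (2 <= n)%N) :
  n%:R / (2 - ln 2) <= Fn R n.
Proof.
apply: lb_le_inf; first by have [] := @Fn_has_inf R n hn.
move=> _ [x /= nx <-]; have [[a Aa <-] _] := Fx_min hn nx.
by apply: Fxa_ge => //; exact: ltnW.
Qed.
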